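(* Let $x,y\in I^d$ be partitioned into $M$ subvectors $x_{i\cdot},y_{i\cdot}$, $1\le i\le M$, as described in the context. The Bregman distance between $x$ and $y$ is bounded by the sum of the upper bounds from the subspaces: $$D_f(x,y)\le UB(x,y),\qquad\text{where}\qquad UB(x,y)=\sum_{i=1}^{M}UB(x_{i\cdot},y_{i\cdot}).$$
   Context: Let $I\subseteq\mathbb{R}$ be an open interval and $f:I\to\mathbb{R}$ a differentiable convex function. The same letter $f$ denotes the separable extension to vectors $v=(v_1,\dots,v_m)\in I^m$ (any $m$): $f(v)=\sum_{j=1}^m f(v_j)$; thus $\frac{\partial f(v)}{\partial v_j}=f'(v_j)$. The Bregman distance between $u,v\in I^m$ is $D_f(u,v)=f(u)-f(v)-\langle\nabla f(v),u-v\rangle$. Let $d,M$ be positive integers with $M\le d$. A vector $x\in I^d$ is partitioned into $M$ subvectors of consecutive coordinates, $x_{i\cdot}=(x_{\lceil d/M\rceil(i-1)+1},\dots,x_{\lceil d/M\rceil i})=(x_{i1},\dots,x_{i\lceil d/M\rceil})$, $1\le i\le M$, and $y$ is partitioned in the same manner. If $M$ does not divide $d$, coordinates with index larger than $d$ are simply absent (the corresponding terms are omitted from all sums). For each $i$, the subspace upper bound is $$UB(x_{i\cdot},y_{i\cdot})=\sum_{j} f(x_{ij})-\sum_{j} f(y_{ij})+\sum_{j} y_{ij}f'(y_{ij})+\sqrt{\Big(\sum_{j}x_{ij}^2\Big)\Big(\sum_{j}f'(y_{ij})^2\Big)},$$ with $j$ ranging over $1,\dots,\lceil d/M\rceil$.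 *)

(* Defs.v *)
From mathcomp Require Import all_boot all_order all_algebra.
From mathcomp Require Import all_classical all_reals all_analysis.
Set Implicit Arguments.
Unset Strict Implicit.
Unset Printing Implicit Defensive.
Import Order.TTheory GRing.Theory Num.Theory.
Import numFieldNormedType.Exports.
Local Open Scope classical_set_scope.
Local Open Scope ring_scope.

(* A function on an open interval I is represented by a total f : R -> R; all
   hypotheses on f, and all its values and derivatives used at vectors with
   coordinates in I, depend only on the restriction of f to I. *)

Definition separable (R : realType) (f : R -> R) (m : nat) (v : 'rV[R]_m) : R :=
  \sum_(j < m) f (v 0 j).

Definition dotrv (R : realType) (m : nat) (u v : 'rV[R]_m) : R :=
  \sum_(j < m) u 0 j * v 0 j.

Definition gradient (R : realType) (m : nat) (F : 'rV[R]_m -> R)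
    (v : 'rV[R]_m) : 'rV[R]_m :=
  \row_(j < m) 'D_(delta_mx 0 j) F v.

Definition bregman (R : realType) (m : nat) (F : 'rV[R]_m -> R)
    (u v : 'rV[R]_m) : R :=
  F u - F v - dotrv (gradient F v) (u - v).

Definition ceil_div (d M : nat) : nat := ((d + M.-1) %/ M)%N.

(* Blocks are numbered from 0: block i holds the coordinates of index
   ceil(d/M) * i + j with j < ceil(d/M), except those of index >= d.
   The last blocks may therefore be shorter, or even empty
   (as for d = 5, M = 4, where the sizes are 2, 2, 1, 0). *)
Definition block_size (d M i : nat) : nat :=
  minn (ceil_div d M) (d - ceil_div d M * i).

Lemma block_index_lt (d M i : nat) (j : 'I_(block_size d M i)) :
  (ceil_div d M * i + j < d)%N.
Proof.
by have := ltn_ord j; rewrite /block_size leq_min ltn_subRL => /andP[_].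
Qed.

Definition subvector (R : realType) (d M : nat) (x : 'rV[R]_d) (i : nat) :
    'rV[R]_(block_size d M i) :=
  \row_(j < block_size d M i) x 0 (Ordinal (block_index_lt j)).

Definition subspace_UB (R : realType) (f : R -> R) (m : nat)
    (x y : 'rV[R]_m) : R :=
  \sum_(j < m) f (x 0 j) - \sum_(j < m) f (y 0 j)
  + \sum_(j < m) y 0 j * f^`()%classic (y 0 j)
  + Num.sqrt ((\sum_(j < m) x 0 j ^+ 2)
              * (\sum_(j < m) f^`()%classic (y 0 j) ^+ 2)).

Definition total_UB (R : realType) (f : R -> R) (d M : nat)
    (x y : 'rV[R]_d) : R :=
  \sum_(i < M) subspace_UB f (subvector M x i) (subvector M y i).

(* Main.v *)
(* The partial derivatives of a separable function are [f'(v_j)], so the Bregman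
   distance is a sum of scalar contributions and splits along the blocks.  On
   each block, the only term replaced is [- <f'(y), x>], which Cauchy-Schwarz
   bounds by [||x|| ||f'(y)||]. *)
Require Import Defs.
From mathcomp Require Import all_boot all_order all_algebra.
From mathcomp Require Import all_classical all_reals all_analysis.
From mathcomp Require Import ring zify.
Import Order.TTheory GRing.Theory Num.Theory.
Import numFieldNormedType.Exports.
Local Open Scope classical_set_scope.
Local Open Scope ring_scope.

(* The difference quotients on the two sides are equal as functions of the step. *)
Lemma derive_separable (R : realType) (f : R -> R) (m : nat) (v : 'rV[R]_m)
    (j : 'I_m) :
  'D_(delta_mx 0 j) (separable f (m := m)) v = f^`()%classic (v 0 j).
Proof.
rewrite derive1E /derive; set q := fun h => _; set r := fun h => _.
suff -> : q = r by []; apply/funext => h; rewrite /q /r /=; congr (_ *: _).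
rewrite /separable (bigD1 j) //= (bigD1 j (P := predT)) //=.
rewrite !mxE !eqxx /=.
(* The other coordinates do not move, so their terms cancel in the difference. *)
rewrite (eq_bigr (fun k => f (v 0 k))) => [|k /negPf kj]; last first.
  by rewrite !mxE kj andbF mulr0 add0r.
by rewrite opprD addrACA subrr addr0 [h *: 1]/GRing.scale.
Qed.

Lemma bregman_separable (R : realType) (f : R -> R) (m : nat) (x y : 'rV[R]_m) :
  bregman (separable f (m := m)) x y =
  \sum_(k < m) (f (x 0 k) - f (y 0 k) - f^`()%classic (y 0 k) * (x 0 k - y 0 k)).
Proof.
rewrite /bregman /dotrv 2!sumrB; congr (_ - _).
by apply: eq_bigr => k _; rewrite !mxE derive_separable.
Qed.

(** Lagrange's identity: twice the gap between the two sides is a double sum of squares. *)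
Lemma sqr_sum_mul_le (R : realType) (m : nat) (a b : 'I_m -> R) :
  (\sum_(i < m) a i * b i) ^+ 2 <=
  (\sum_(i < m) a i ^+ 2) * (\sum_(i < m) b i ^+ 2).
Proof.
have sq_ge0 : 0 <= \sum_(i < m) \sum_(j < m) (a i * b j - a j * b i) ^+ 2.
  by apply: sumr_ge0 => i _; apply: sumr_ge0 => j _; exact: sqr_ge0.
have sqE : \sum_(i < m) \sum_(j < m) (a i * b j - a j * b i) ^+ 2 =
    ((\sum_(i < m) a i ^+ 2) * (\sum_(i < m) b i ^+ 2)
     - (\sum_(i < m) a i * b i) ^+ 2) *+ 2.
  (* Commuting one of the two copies of the product yields the terms [b i ^+ 2 * a j ^+ 2], so both
     sides agree for each pair [(i, j)]. *)
  rewrite mulrnBl [in RHS]mulr2n [X in _ + X - _]mulrC expr2.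
  rewrite !big_distrlr /= -sumrMnl -big_split -sumrB; apply: eq_bigr => i _ /=.
  rewrite -sumrMnl -big_split -sumrB.
  by apply: eq_bigr => j _ /=; ring.
by move: sq_ge0; rewrite sqE pmulrn_lge0 // subr_ge0.
Qed.

Lemma sum_le_subspace_UB (R : realType) (f : R -> R) (m : nat)
    (x y : 'rV[R]_m) :
  \sum_(k < m) (f (x 0 k) - f (y 0 k) - f^`()%classic (y 0 k) * (x 0 k - y 0 k))
  <= subspace_UB f x y.
Proof.
have CS := sqr_sum_mul_le _ _ (x 0) (fun k => f^`()%classic (y 0 k)).
(* The inner product enters with a minus sign, so its lower bound is the half to keep. *)
have := ler_wsqrtr CS; rewrite sqrtr_sqr ler_norml => /andP[CSl _].
have -> : \sum_(k < m) (f (x 0 k) - f (y 0 k) - f^`()%classic (y 0 k) * (x 0 k - y 0 k))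
    = \sum_(k < m) f (x 0 k) - \sum_(k < m) f (y 0 k)
      + \sum_(k < m) y 0 k * f^`()%classic (y 0 k)
      - \sum_(k < m) x 0 k * f^`()%classic (y 0 k).
  rewrite -sumrB -big_split -sumrB; apply: eq_bigr => k _ /=; ring.
by rewrite /subspace_UB lerD2l lerNl.
Qed.

Lemma leq_ceil_divM (d M : nat) : (0 < M)%N -> (d <= ceil_div d M * M)%N.
Proof.
move=> M_gt0; rewrite /ceil_div.
by have := divn_eq (d + M.-1) M; have := ltn_pmod (d + M.-1) M_gt0; lia.
Qed.

(** The range truncated at [c * M] makes induction on [M] possible; indexing [g] by [nat] avoids
    carrying bound proofs. *)
Lemma sum_blocks_nat (V : nmodType) (c d M : nat) (g : nat -> V) :
  \sum_(i < M) \sum_(j < minn c (d - c * i)) g (c * i + j)%N =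
  \sum_(k < minn d (c * M)) g k.
Proof.
elim: M => [|M IH]; first by rewrite muln0 minn0 !big_ord0.
rewrite big_ord_recr /= IH; have [dM|Md] := leqP d (c * M).
  (* All [d] indices are already used up, so the new block is empty. *)
  rewrite (eqP (_ : d - c * M == 0)%N) ?subn_eq0// minn0 big_ord0 addr0.
  by rewrite (minn_idPl _)// (leq_trans dM)// leq_mul2l leqnSn orbT.
have -> : minn d (c * M.+1) = (c * M + minn c (d - c * M))%N by lia.
by rewrite big_split_ord.
Qed.

Lemma sum_blocks (V : nmodType) (d M : nat) (G : 'I_d -> V) : (0 < M)%N ->
  \sum_(i < M) \sum_(j < block_size d M i) G (Ordinal (block_index_lt j)) =
  \sum_(k < d) G k.
Proof.
(* The default [0] is never reached: every index in a block is below [d]. *)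
move=> M_gt0; pose g n := if insub n is Some k then G k else 0.
have gE (k : 'I_d) : g k = G k by rewrite /g valK.
have := sum_blocks_nat _ (ceil_div d M) d M g.
rewrite (minn_idPl (leq_ceil_divM d M M_gt0)) (eq_bigr G) => [<-|k _] //.
by apply: eq_bigr => i _; apply: eq_bigr => j _; rewrite -gE.
Qed.

Theorem theorem2 (R : realType) (I : set R) (f : R -> R)
    (I_open : open I) (I_itv : is_interval I)
    (f_derivable : forall t : R, I t -> derivable f t 1)
    (f_convex : convex_function (E := R^o) I f)
    (d M : nat) (M_gt0 : (0 < M)%N) (M_le_d : (M <= d)%N)
    (x y : 'rV[R]_d)
    (x_in_I : forall k : 'I_d, I (x 0 k))
    (y_in_I : forall k : 'I_d, I (y 0 k)) :
  bregman (separable f (m := d)) x y <= total_UB f M x y.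
Proof.
rewrite bregman_separable -(sum_blocks _ _ M _ M_gt0); apply: ler_sum => i _.
(* What remains is an equality: entries of [subvector] are entries of [x] and [y]. *)
apply: le_trans (sum_le_subspace_UB _ _ _ _ _); rewrite le_eqVlt; apply/orP; left.
by apply/eqP/eq_bigr => j _; rewrite !mxE.
Qed.
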